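(* Let $n,k,\gamma$ be positive integers with $\gamma+1\le k<3\lceil\gamma/2\rceil$ and $n\ge2k+\gamma$. Then $$B_2(n,k,k+\gamma;3)\ge 2^{2\left\lfloor\frac{n-2k+1}{k+1}\right\rfloor}.$$
   Context: For a prime power $q$, $\mathcal{G}_q(n,k)$ denotes the set of all $k$-dimensional subspaces of $\mathbb{F}_q^n$. An $\alpha$-$(n,k,\delta)_q^c$ covering Grassmannian code is a subset $\mathcal{C}\subseteq\mathcal{G}_q(n,k)$ (no repeated codewords) such that every set of $\alpha$ distinct codewords of $\mathcal{C}$ spans a subspace of $\mathbb{F}_q^n$ of dimension at least $k+\delta$. $B_q(n,k,\delta;\alpha)$ denotes the maximum size of an $\alpha$-$(n,k,\delta)_q^c$ code. *)

(* Defs.v *)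
From HB Require Import structures.
From mathcomp Require Import all_boot all_order all_algebra all_field.
Set Implicit Arguments. Unset Strict Implicit. Unset Printing Implicit Defensive.
Import GRing.Theory.
Local Open Scope ring_scope.

Definition covering_code (F : finFieldType) (n k delta alpha : nat)
    (C : seq {vspace 'rV[F]_n}) : Prop :=
  [/\ uniq C,
      (forall U, U \in C -> \dim U = k) &
      (forall S : seq {vspace 'rV[F]_n},
         uniq S -> size S = alpha -> {subset S <= C} ->
         (k + delta <= \dim (\sum_(U <- S) U)%VS)%N)].

(* Main.v *)
Require Import Defs.
From HB Require Import structures.
From mathcomp Require Import all_boot all_order all_algebra all_field.
From mathcomp Require Import zify ring.
Set Implicit Arguments. Unset Strict Implicit. Unset Printing Implicit Defensive.
Import GRing.Theory VectorInternalTheory.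
Local Open Scope ring_scope.

(** The codewords are graphs {(u, A_x u)} of linear maps A_x : F_2^k -> Y with
    k + dim Y <= n.  Three distinct graphs span dimension at least
    3k - 1 >= 2k + gamma as soon as (A_x - A_z) u + (A_y - A_z) v = 0 has at
    most one nonzero solution (u, v).  Put m = floor((n - 2k + 1) / (k + 1)).

    If k >= 3 and m >= 1, let L be the field of order 2^N, N = max(k, 2m),
    embed F_2^k in L, and take A_x u = (x u, x u^2) for x in L.  With
    a = x - z and b = y - z, the equations a u + b v = a u^2 + b v^2 = 0 force
    b v (u - v) = 0, hence u = v = 0.

    If k = 2, take A_(a,b) (c, d) = (c a + d b, c b, d a) with a, b in F_2^m.  A
    solution is determined by a vector t such that (t, 0) and (0, t) lie in the
    plane spanned by x - z and y - z, and there is at most one such t <> 0.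

    If m = 0, a single codeword suffices. *)

(** * Dimensions and embeddings of vector spaces *)

Lemma dim_rV (F : fieldType) n : dim 'rV[F]_n = n.
Proof. exact: mul1n. Qed.

Lemma dim_prod (F : fieldType) (V W : vectType F) :
  dim (V * W)%type = (dim V + dim W)%N.
Proof. by []. Qed.

Lemma exists_embedding (F : fieldType) (V W : vectType F) :
  (dim V <= dim W)%N -> exists f : {linear V -> W}, injective f.
Proof.
move=> leVW; pose f (v : V) : W := r2v (v2r v *m pid_mx (dim V)).
have lin_f : linear f.
  by move=> a u v; rewrite /f linearP /= mulmxDl -scalemxAl linearP.
pose fL : {linear V -> W} :=
  HB.pack f (GRing.isLinear.Build F V W *:%R f lin_f).
exists fL => u v /r2v_inj eq_uv.
have fK (w : 'rV_(dim V)) : w *m pid_mx (dim V) *m (pid_mx (dim V) : 'M_(dim W, dim V)) = w.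
  by rewrite -mulmxA pid_mx_id // pid_mx_1 mulmx1.
by apply: v2r_inj; rewrite -[v2r u]fK eq_uv fK.
Qed.

Lemma dim_le1 (F : fieldType) (V : vectType F) (K : {vspace V}) :
  (forall p q, p \in K -> q \in K -> p != 0 -> q != 0 -> p = q) ->
  (\dim K <= 1)%N.
Proof.
move=> eqK; rewrite leqNgt; apply/negP => lt1.
have b_free := basis_free (vbasisP K).
have lt0 : (0 < \dim K)%N by apply: ltn_trans lt1.
have s0 := size_tuple (vbasis K).
have m i : (i < \dim K)%N -> (vbasis K)`_i \in K /\ (vbasis K)`_i != 0.
  move=> lti; have bi : (vbasis K)`_i \in vbasis K by rewrite mem_nth ?s0.
  split; first exact: vbasis_mem.
  exact: free_not0 b_free bi.
have [[K0 n0] [K1 n1]] := (m _ lt0, m _ lt1).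
have /eqP := eqK _ _ K0 K1 n0 n1.
by rewrite nth_uniq ?s0 ?free_uniq.
Qed.

(** * Codes whose codewords are graphs of linear maps *)

Section GraphCode.

Variables (F : finFieldType) (n k gamma : nat) (X : finType) (Y : vectType F).
Variable A : X -> {linear 'rV[F]_k -> Y}.

Hypothesis gamma_lt : (gamma < k)%N.
Hypothesis dimY : (k + dim Y <= n)%N.
Hypothesis A_inj : forall x y, A x =1 A y -> x = y.
Hypothesis A_ker : forall x y z, x != y -> x != z -> y != z ->
  forall u v u' v',
  A x u - A z u + (A y v - A z v) = 0 -> A x u' - A z u' + (A y v' - A z v') = 0 ->
  (u, v) != 0 -> (u', v') != 0 -> (u, v) = (u', v').

Lemma graph_code : exists C : seq {vspace 'rV[F]_n},
  covering_code k (k + gamma) 3 C /\ size C = #|X|.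
Proof.
have le_dim : (dim ('rV[F]_k * Y)%type <= dim 'rV[F]_n)%N.
  by rewrite dim_prod !dim_rV.
have [e e_inj] := exists_embedding le_dim.
pose g x (u : 'rV[F]_k) : 'rV[F]_n := e (u, A x u).
have g_lin x : linear (g x).
  by move=> a u v; rewrite /g (linearP (A x)) -(linearP e).
pose gL x : {linear 'rV[F]_k -> 'rV[F]_n} :=
  HB.pack (g x) (GRing.isLinear.Build F _ _ *:%R (g x) (g_lin x)).
pose cw x := limg (linfun (gL x)).
have g_inj x : injective (g x) by move=> u v /e_inj [].
have mem_cw x u : g x u \in cw x.
  by rewrite -[g x u](lfunE (gL x)) memv_img ?memvf.
have cw_inj : injective cw.
  move=> x y eq_cw; apply: A_inj => u.
  have := mem_cw x u; rewrite eq_cw => /memv_imgP [v _].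
  by rewrite lfunE => /e_inj [<-].
exists [seq cw x | x : X]; split; last by rewrite size_map -cardE.
split.
- by rewrite map_inj_uniq ?enum_uniq.
- move=> U /mapP [x _ ->]; rewrite /cw limg_dim_eq ?dimvf ?dim_rV //.
  apply/eqP; rewrite -subv0; apply/subvP => u.
  rewrite memv_cap memvf memv_ker lfunE memv0 /= -(linear0 (gL x)).
  by rewrite (inj_eq (@g_inj x)).
case=> [|U1 [|U2 [|U3 [|]]]] //= S_uniq _ sub_S.
have get U : U \in [:: U1; U2; U3] -> exists x, U = cw x.
  by move=> /sub_S /mapP [x _ ->]; exists x.
have [[x def1] [y def2] [z def3]] :
  [/\ exists x, U1 = cw x, exists x, U2 = cw x & exists x, U3 = cw x].
  by split; apply: get; rewrite !inE eqxx ?orbT.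
move: S_uniq; rewrite {}def1 {}def2 {}def3 !inE !(inj_eq cw_inj) negb_or.
rewrite andbT => /andP [/andP [xy xz] yz].
rewrite !big_cons big_nil addv0 {sub_S get}.
(* The image of [h] lies in the sum of the three codewords. Its source has dimension 3k, so a kernel
   of dimension at most 1 leaves 3k - 1 >= 2k + gamma. *)
pose T : vectType F := ('rV[F]_k * ('rV[F]_k * 'rV[F]_k))%type.
pose h (t : T) : 'rV[F]_n := g x t.1 + (g y t.2.1 + g z t.2.2).
have h_lin : linear h.
  move=> a s t.
  by rewrite /h /= !g_lin !scalerDr (addrACA (a *: g y _)) [LHS]addrACA.
pose hL : {linear T -> 'rV[F]_n} :=
  HB.pack h (GRing.isLinear.Build F _ _ *:%R h h_lin).
have sub_h : (limg (linfun hL) <= cw x + (cw y + cw z))%VS.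
  by apply/subvP => _ /memv_imgP [t _ ->]; rewrite lfunE; do !apply: memv_add.
apply: leq_trans (dimvS sub_h).
have := limg_ker_dim (linfun hL) fullv; rewrite capfv.
have -> : \dim {:T} = (k + (k + k))%N by rewrite dimvf !dim_prod dim_rV.
suff : (\dim (lker (linfun hL)) <= 1)%N by lia.
apply: dim_le1 => -[u [v w]] [u' [v' w']].
(* The first coordinate of a kernel vector gives r = -(p + q); substituted into the second, this
   yields the equation of [A_ker]. *)
have kerE p q r : (p, (q, r)) \in lker (linfun hL) ->
    r = - (p + q) /\ A x p - A z p + (A y q - A z q) = 0.
  rewrite memv_ker lfunE /= /h /g /= -!linearD -(linear0 e) => /eqP /e_inj.
  case; rewrite addrA => /eqP; rewrite addrC addr_eq0 => /eqP -> A0; split=> //.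
  by move: A0; rewrite linearN linearD opprD addrA addrACA addrA.
move=> /kerE [-> e1] /kerE [-> e2] n1 n2.
have nz p q : (p, (q, - (p + q))) != 0 :> T ->
    (p, q) != 0 :> ('rV[F]_k * 'rV[F]_k)%type.
  by apply: contraNneq => -[-> ->]; rewrite addr0 oppr0.
by have [-> ->] := A_ker xy xz yz e1 e2 (nz _ _ n1) (nz _ _ n2).
Qed.

End GraphCode.

(** * Scalars, linearity and field extensions over F_2 *)

Lemma F2_cases (a : 'F_2) : a = 0 \/ a = 1.
Proof. by case: a => -[|[|]] // lt; [left | right]; apply: val_inj. Qed.

Lemma linear_F2 (V W : lmodType 'F_2) (f : V -> W) :
  {morph f : u v / u + v} -> linear f.
Proof.
move=> fD a u v; rewrite fD; congr (_ + _).
have f0 : f 0 = 0 by apply: (addrI (f 0)); rewrite -fD !addr0.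
by case: (F2_cases a) => ->; rewrite ?scale0r ?scale1r.
Qed.

Lemma card_rV_F2 n : #|{: 'rV['F_2]_n}| = (2 ^ n)%N.
Proof. by rewrite card_mx card_Fp // mul1n. Qed.

Lemma exists_F2_extension N :
  (0 < N)%N -> exists L : fieldExtType 'F_2, dim L = N.
Proof.
move=> N_gt0; have [L charL cardL] := pPrimePowerField (isT : prime 2) N_gt0.
exists (pPrimeCharType charL : fieldExtType 'F_2).
by rewrite -dimvf pprimeChar_dimf cardL pfactorK.
Qed.

(** * The code used for k >= 3 *)

Lemma quadratic_code n k gamma N :
  (gamma < k)%N -> (k <= N)%N -> (k + (N + N) <= n)%N ->
  exists C : seq {vspace 'rV['F_2]_n},
    covering_code (F := 'F_2) k (k + gamma) 3 C /\ size C = (2 ^ N)%N.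
Proof.
move=> gamma_lt le_kN le_n.
have N_gt0 : (0 < N)%N by lia.
have [L dimL] := exists_F2_extension N_gt0.
have char2 : 2 \in [pchar L] by rewrite pchar_lalg pchar_Fp.
have [i i_inj] : exists i : {linear 'rV['F_2]_k -> L}, injective i.
  by apply: exists_embedding; rewrite dim_rV dimL.
(* [j] labels the multipliers in [L] by a finite type with 2^N elements. *)
have [j j_inj] : exists j : {linear 'rV['F_2]_N -> L}, injective j.
  by apply: exists_embedding; rewrite dim_rV dimL.
pose A x u : (L * L)%type := (j x * i u, j x * i u ^+ 2).
have A_lin x : linear (A x).
  apply: linear_F2 => u v; rewrite /A linearD /= mulrDr.
  by rewrite -!(pFrobenius_autE char2) rmorphD mulrDr.
pose AL x : {linear 'rV['F_2]_k -> (L * L)%type} :=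
  HB.pack (A x) (GRing.isLinear.Build 'F_2 _ _ *:%R (A x) (A_lin x)).
rewrite -card_rV_F2; apply: (@graph_code _ _ _ _ _ _ AL) => //.
- by rewrite dim_prod dimL.
- move=> x y eqA; have k_gt0 : (0 < k)%N by lia.
  have [eq1 _] := eqA (const_mx 1); apply: j_inj; apply: mulIf eq1.
  rewrite -(linear0 i) (inj_eq i_inj); apply/eqP => /rowP /(_ (Ordinal k_gt0)).
  by rewrite !mxE => /eqP; rewrite oner_eq0.
move=> x y z xy xz yz u v u' v' [e1 e2] _ /eqP nz _; case: nz.
move: e1 e2; rewrite -!mulrBl => e1 e2.
have jxz : j x - j z != 0 by rewrite subr_eq0 (inj_eq j_inj).
have jyz : j y - j z != 0 by rewrite subr_eq0 (inj_eq j_inj).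
(* Multiplying the first equation by [i u] and subtracting the second eliminates the terms in
   [j x - j z]. *)
have bvuv : (j y - j z) * i v * (i u - i v) = 0.
  transitivity (((j x - j z) * i u + (j y - j z) * i v) * i u
      - ((j x - j z) * i u ^+ 2 + (j y - j z) * i v ^+ 2)); first by ring.
  by rewrite e1 e2 mul0r subr0.
have i0 w : i w = 0 -> w = 0 by rewrite -(linear0 i) => /i_inj.
move/eqP: bvuv; rewrite mulf_eq0 mulf_eq0 (negPf jyz) /= => /orP [].
  move/eqP=> iv0; move/eqP: e1; rewrite iv0 mulr0 addr0 mulf_eq0 (negPf jxz) /=.
  by move/eqP/i0 ->; rewrite (i0 _ iv0).
(* When u = v the first equation has coefficient (x - z) + (y - z), which is x - y in characteristic
   2, hence nonzero. *)
rewrite subr_eq0 (inj_eq i_inj) => /eqP eq_uv; move/eqP: e1.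
rewrite eq_uv -mulrDl mulf_eq0 => /orP [|/eqP/i0 ->] //.
rewrite -[j y - j z](oppr_pchar2 char2) opprB addrA subrK subr_eq0.
by rewrite (inj_eq j_inj) (negPf xy).
Qed.

(** * The code used for k = 2 *)

Lemma F2_independent (V : lmodType 'F_2) (p q : V) :
  p != 0 -> q != 0 -> p != q ->
  forall c d, c *: p + d *: q = 0 -> c = 0 /\ d = 0.
Proof.
move=> /eqP p0 /eqP q0 /eqP pq c d.
case: (F2_cases c) (F2_cases d) => -> [] ->.
- by [].
- by rewrite scale0r scale1r add0r.
- by rewrite scale0r scale1r addr0.
(* Here c = d = 1, and p + q = p - q is nonzero. *)
rewrite -{2}[1](oppr_pchar2 (pchar_Fp (isT : prime 2))) scaleNr !scale1r => /eqP.
by rewrite subr_eq0 => /eqP.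
Qed.

(** The pairs (-t, 0) and (0, t) are independent, so the coefficient determinant [D] is nonzero and
    they span the same plane as p and q. Thus (-s, 0) is a combination of them, s is a scalar
    multiple of t, and the only nonzero scalar is 1. *)
Lemma diagonal_pair_unique (V : lmodType 'F_2) (p q : V * V) (t s : V)
    (c0 c1 d0 d1 a0 b0 : 'F_2) :
  c0 *: p + d0 *: q = (- t, 0) -> c1 *: p + d1 *: q = (0, t) ->
  a0 *: p + b0 *: q = (- s, 0) -> t != 0 -> s != 0 -> t = s.
Proof.
move=> eP eQ eP' t0 s0.
have lin a b : (- (a *: t), b *: t) =
    (a * c0 + b * c1) *: p + (a * d0 + b * d1) *: q.
  transitivity (a *: (c0 *: p + d0 *: q) + b *: (c1 *: p + d1 *: q)).
    rewrite eP eQ; congr (_, _); rewrite /= !scaler0 ?addr0 ?add0r //.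
    by rewrite scalerN.
  by rewrite !scalerDr !scalerA addrACA -!scalerDl.
have scale_t0 c : c *: t = 0 -> c = 0.
  by move=> /eqP; rewrite scaler_eq0 (negPf t0) orbF => /eqP.
pose D := c0 * d1 - c1 * d0.
have D1 : D = 1.
  case: (F2_cases D) => // D0.
  have := lin d1 (- d0); have := lin (- c1) c0.
  have -> : - c1 * c0 + c0 * c1 = 0 by ring.
  have -> : - c1 * d0 + c0 * d1 = 0 by rewrite -D0 /D; ring.
  have -> : d1 * c0 + - d0 * c1 = 0 by rewrite -D0 /D; ring.
  have -> : d1 * d0 + - d0 * d1 = 0 by ring.
  rewrite !scale0r addr0 => -[_ /scale_t0 c00] -[_ /scale_t0 /eqP].
  rewrite oppr_eq0 => /eqP d00; move: eP; rewrite c00 d00 !scale0r addr0.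
  by case=> /eqP; rewrite eq_sym oppr_eq0 (negPf t0).
(* By Cramer's rule, these coefficients produce [D] times the combination given by [a0] and [b0]. *)
have := lin (a0 * d1 - b0 * c1) (c0 * b0 - d0 * a0).
have -> : (a0 * d1 - b0 * c1) * c0 + (c0 * b0 - d0 * a0) * c1 = D * a0.
  by rewrite /D; ring.
have -> : (a0 * d1 - b0 * c1) * d0 + (c0 * b0 - d0 * a0) * d1 = D * b0.
  by rewrite /D; ring.
rewrite D1 !mul1r eP' => -[/oppr_inj + _].
by case: (F2_cases (a0 * d1 - b0 * c1)) => ->; rewrite ?scale1r ?scale0r // => e0;
   rewrite -e0 eqxx in s0.
Qed.

Lemma binary_line_code n m :
  (2 + 3 * m <= n)%N ->
  exists C : seq {vspace 'rV['F_2]_n},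
    covering_code (F := 'F_2) 2 3 3 C /\ size C = (2 ^ (2 * m))%N.
Proof.
move=> le_n; pose V := 'rV['F_2]_m; pose Y : vectType 'F_2 := (V * (V * V))%type.
pose A (x : V * V) (u : 'rV['F_2]_2) : Y :=
  (u 0 0 *: x.1 + u 0 1 *: x.2, (u 0 0 *: x.2, u 0 1 *: x.1)).
have A_lin x : linear (A x).
  apply: linear_F2 => u v; rewrite /A !mxE !scalerDl.
  by congr (_, _); rewrite addrACA.
pose AL x : {linear 'rV['F_2]_2 -> Y} :=
  HB.pack (A x) (GRing.isLinear.Build 'F_2 _ _ *:%R (A x) (A_lin x)).
have -> : (2 ^ (2 * m))%N = #|{: V * V}|.
  by rewrite card_prod !card_rV_F2 -expnD addnn mul2n.
apply: (@graph_code _ _ _ _ _ _ AL) => //.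
- by rewrite !dim_prod !dim_rV; lia.
- move=> [a b] [a' b'] /(_ (\row_l (l == 0)%:R)).
  by rewrite /= /A /= !mxE /= !scale1r !scale0r !addr0 => -[-> ->].
move=> x y z xy xz yz.
pose p := x - z; pose q := y - z.
have p0 : p != 0 by rewrite subr_eq0.
have q0 : q != 0 by rewrite subr_eq0.
have pq : p != q by rewrite (inj_eq (addIr _)).
(* The last two coordinates of [A] kill one component of each combination; the first coordinate
   makes the surviving components opposite. *)
have kerE u v : A x u - A z u + (A y v - A z v) = 0 -> exists t,
    u 0 0 *: p + v 0 0 *: q = (- t, 0) /\ u 0 1 *: p + v 0 1 *: q = (0, t).
  case=> e1 e2 e3; exists (u 0 1 *: p.2 + v 0 1 *: q.2); split.
    congr (_, _); rewrite /= !scalerBr //; apply/eqP; rewrite -addr_eq0.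
    by rewrite -e1 !opprD addrACA (addrACA (_ *: x.1)) (addrACA (_ *: y.1)).
  by congr (_, _); rewrite /= !scalerBr.
move=> u v u' v' /kerE [t [e1 e2]] /kerE [s [e1' e2']] nz nz'.
have row2P (w w' : 'rV['F_2]_2) : w 0 0 = w' 0 0 -> w 0 1 = w' 0 1 -> w = w'.
  move=> eq0 eq1; apply/rowP => l.
  have [->|->] // : l = 0 \/ l = 1 := F2_cases l.
have ker0 (w w' : 'rV['F_2]_2) : w 0 0 *: p + w' 0 0 *: q = 0 ->
    w 0 1 *: p + w' 0 1 *: q = 0 -> (w, w') = 0.
  move=> /(F2_independent p0 q0 pq) [w0 w0'] /(F2_independent p0 q0 pq) [w1 w1'].
  by congr (_, _); apply: row2P; rewrite mxE.
(* If t or s were 0, independence of p and q would make the corresponding solution zero. *)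
have eq_ts : t = s.
  apply: (diagonal_pair_unique e1 e2 e1').
    by apply: contra_neq nz => t0; apply: ker0; rewrite ?e1 ?e2 t0 ?oppr0.
  by apply: contra_neq nz' => s0; apply: ker0; rewrite ?e1' ?e2' s0 ?oppr0.
have sub c d c' d' : c *: p + d *: q = c' *: p + d' *: q -> c = c' /\ d = d'.
  move/eqP; rewrite -subr_eq0 opprD addrACA -!scalerBl.
  move=> /eqP /(F2_independent p0 q0 pq) [/eqP + /eqP].
  by rewrite !subr_eq0 => /eqP -> /eqP ->.
move: e1 e2; rewrite eq_ts -e1' -e2' => /sub [u0 v0] /sub [u1 v1].
by congr (_, _); apply: row2P.
Qed.

(* B_2(n,k,k+gamma;3) >= 2^(2 floor((n-2k+1)/(k+1))):
   there is a 3-(n,k,k+gamma)_2^c code of at least that size. *)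
Theorem mainTheorem11 (n k gamma : nat) :
  (0 < n)%N -> (0 < k)%N -> (0 < gamma)%N ->
  (gamma + 1 <= k)%N -> (k < 3 * ((gamma + 1) %/ 2))%N ->
  (2 * k + gamma <= n)%N ->
  exists C : seq {vspace 'rV['F_2]_n},
    @covering_code ('F_2 : finFieldType) n k (k + gamma) 3 C /\
    (2 ^ (2 * ((n + 1 - 2 * k) %/ (k + 1))) <= size C)%N.
Proof.
move=> n_gt0 k_gt0 gamma_gt0 gamma_lt _ le_n.
have := leq_trunc_div (n + 1 - 2 * k) (k + 1).
set m := (_ %/ _)%N => le_m; case: (posnP m) => [->|m_gt0].
  (* The bound is 2^0 = 1: one graph, of the zero map, suffices and the conditions on distinct
     indices are vacuous. *)
  have [C [CC sC]] : exists C : seq {vspace 'rV['F_2]_n},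
      covering_code (F := 'F_2) k (k + gamma) 3 C /\ size C = #|{: unit}|.
    apply: (@graph_code _ _ _ _ _ 'rV['F_2]_0 (fun=> \0)).
    - by lia.
    - by rewrite dim_rV; lia.
    - by case=> -[].
    - by case=> -[].
  by exists C; rewrite sC card_unit.
(* The case k = 2, where gamma = 1, is separate: the quadratic code would need 2 + 4m <= n, while
   only 3m + 3 <= n is known. *)
have [k2|k3] : k = 2 \/ (3 <= k)%N by lia.
  have [|C [CC sC]] := @binary_line_code n m; first by nia.
  exists C; rewrite sC k2; split=> //.
  by have -> : gamma = 1%N by lia.
(* For k + 2N <= n: if N = k, then m >= 1 gives n >= 3k; if N = 2m, then k >= 3 gives m(k + 1) >=
   4m, so n >= k + 4m. *)
have [|||C [CC sC]] := @quadratic_code n k gamma (maxn k (2 * m)).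
- by lia.
- by lia.
- by nia.
by exists C; rewrite sC leq_exp2l //; split => //; lia.
Qed.
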